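(* Let $(X,R)$ be a countable homogeneous relational structure with oligomorphic automorphism group, whose age has the free amalgamation property, and such that $\operatorname{Aut}(X,R)$ is transitive on $X$ and $\operatorname{Aut}(X,R)\neq\mathrm{Sym}(X)$. Then $\operatorname{Aut}(X,R)$ has no mixed identities (in any finite number $r$ of variables).
   Context: A relational structure $(X,R)$ is a countable set $X$ with a family $R=(R_i)_{i\in I}$ of relations $R_i\subseteq X^{m_i}$; substructures are induced substructures. It is homogeneous if every isomorphism between finite substructures extends to an automorphism. $\operatorname{Aut}(X,R)$ is oligomorphic if for every $n\in\mathbb N$ its componentwise action on $X^n$ has only finitely many orbits. The age of $(X,R)$ is the class of all finite structures isomorphic to a substructure of $(X,R)$. A class $\mathcal C$ of finite structures of the same signature has the free amalgamation property if, for all $(X_1,R_1),(X_2,R_2)\in\mathcal C$ inducing the same substructure on $X_0=X_1\cap X_2$, the structure with domain $X_1\cup X_2$ whose $i$-th relation is the union of the $i$-th relations of $(X_1,R_1)$ and $(X_2,R_2)$ lies in $\mathcal C$. For a group $G$ and the free group $\mathbf F_r=\langle x_1,\dots,x_r\rangle$, a word with constants in $G$ is an element $w\in G\ast\mathbf F_r$. For $g_1,\dots,g_r\in G$, $w(g_1,\dots,g_r)\in G$ denotes the image of $w$ under the homomorphism $G\ast\mathbf F_r\to G$ that is the identity on $G$ and sends $x_i\mapsto g_i$. The word $w$ is a mixed identity for $G$ if $w\neq1$ in $G\ast\mathbf F_r$ and $w(g_1,\dots,g_r)=1_G$ for all $g_1,\dots,g_r\in G$. *)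

(* Defs.v *)
(* MathComp, with the classical layer of MathComp-Analysis. *)
From HB Require Import structures.
From mathcomp Require Import all_boot all_classical.

Set Implicit Arguments.
Unset Strict Implicit.
Unset Printing Implicit Defensive.

Local Open Scope classical_set_scope.
Local Open Scope group_scope.
Local Open Scope quotient_scope.

(** * Relational structures *)

(* A structure of signature (I, m) with domain the type T: the tuples of T^n
   are the functions 'I_n -> T.  Arities are arbitrary, 0 included. *)
Definition structure (I : Type) (m : I -> nat) (T : Type) : Type :=
  forall i : I, set ('I_(m i) -> T).

Definition isomorphism I (m : I -> nat) T U (R : structure m T)
    (S : structure m U) (f : T -> U) : Prop :=
  bijective f /\ forall i (t : 'I_(m i) -> T), R i t <-> S i (f \o t).

Definition isomorphic I (m : I -> nat) T U (R : structure m T)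
    (S : structure m U) : Prop :=
  exists f, isomorphism R S f.

Definition induced I (m : I -> nat) T (R : structure m T) (A : set T) :
    structure m A :=
  fun i => [set t | R i (\val \o t)].
Arguments induced {I m T} R A i _.

(** * Automorphism groups *)

Record aut I (m : I -> nat) X (R : structure m X) : Type := Aut {
  aut_fun :> X -> X;
  aut_isom : isomorphism R R aut_fun
}.

Section AutGroup.
Variables (I : Type) (m : I -> nat) (X : Type) (R : structure m X).

Lemma aut_ext (f g : aut R) : f =1 g -> f = g.
Proof.
case: f g => [f hf] [g hg] /= /funext fg.
by case: _ / fg hg => hg; congr Aut; exact: Prop_irrelevance.
Qed.

Lemma aut_id_subproof : isomorphism R R idfun.
Proof. by split; [exists idfun|]. Qed.

Lemma aut_comp_subproof (f g : aut R) : isomorphism R R (f \o g).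
Proof.
case: f g => [f [bf hf]] [g [bg hg]] /=; split; first exact: bij_comp.
by move=> i t; rewrite hg hf.
Qed.

Lemma aut_inv_ex (f : aut R) :
  exists g : aut R, cancel f g /\ cancel g f.
Proof.
case: f => f [[g fK gK] hf].
have hg : isomorphism R R g.
  split; first by exists f.
  move=> i t; rewrite (hf i (g \o t)); suff -> : f \o (g \o t) = t by [].
  by apply/funext => j /=; rewrite gK.
by exists (Aut hg).
Qed.

Definition aut_one : aut R := Aut aut_id_subproof.
Definition aut_mul (f g : aut R) : aut R := Aut (aut_comp_subproof f g).
Definition aut_inv (f : aut R) : aut R := projT1 (cid (aut_inv_ex f)).

Lemma aut_invK (f : aut R) : cancel f (aut_inv f) /\ cancel (aut_inv f) f.
Proof. by rewrite /aut_inv; case: cid. Qed.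

Lemma aut_mulA : associative aut_mul.
Proof. by move=> f g h; exact: aut_ext. Qed.

Lemma aut_mul1 : left_id aut_one aut_mul.
Proof. by move=> f; exact: aut_ext. Qed.

Lemma aut_mulr1 : right_id aut_one aut_mul.
Proof. by move=> f; exact: aut_ext. Qed.

Lemma aut_mulV : left_inverse aut_one aut_inv aut_mul.
Proof. by move=> f; apply: aut_ext => x /=; rewrite (aut_invK f).1. Qed.

Lemma aut_mulrV : right_inverse aut_one aut_inv aut_mul.
Proof. by move=> f; apply: aut_ext => x /=; rewrite (aut_invK f).2. Qed.

HB.instance Definition _ := gen_eqMixin (aut R).
HB.instance Definition _ := gen_choiceMixin (aut R).
HB.instance Definition _ :=
  isGroup.Build (aut R) aut_mulA aut_mul1 aut_mulr1 aut_mulV aut_mulrV.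

Lemma aut_mulE (f g : aut R) (x : X) : (f * g) x = f (g x).
Proof. by []. Qed.

Lemma aut_oneE (x : X) : (1 : aut R) x = x.
Proof. by []. Qed.

End AutGroup.

(** * Properties of structures *)

Definition homogeneous I (m : I -> nat) X (R : structure m X) : Prop :=
  forall (A B : set X) (f : A -> B), finite_set A -> finite_set B ->
    isomorphism (induced R A) (induced R B) f ->
    exists g : aut R, forall a : A, g (\val a) = \val (f a).

Definition orbit_tuple I (m : I -> nat) X (R : structure m X) (n : nat)
    (t : 'I_n -> X) : set ('I_n -> X) :=
  [set (g : aut R) \o t | g in setT].

Definition oligomorphic I (m : I -> nat) X (R : structure m X) : Prop :=
  forall n : nat, finite_set (range (@orbit_tuple I m X R n)).

Definition transitive_aut I (m : I -> nat) X (R : structure m X) : Prop :=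
  forall x y : X, exists g : aut R, g x = y.

Definition age I (m : I -> nat) X (R : structure m X) (T : Type)
    (S : structure m T) : Prop :=
  finite_set [set: T] /\ exists A : set X, isomorphic S (induced R A).

(* The relations of a structure with domain A `<=` U, seen as relations on the
   ambient type U. *)
Definition ambient I (m : I -> nat) U (A : set U) (S : structure m A) :
    structure m U :=
  fun i => [set \val \o s | s in S i].
Arguments ambient {I m U A} S i _.

Definition free_amalgam I (m : I -> nat) U (A1 A2 : set U)
    (S1 : structure m A1) (S2 : structure m A2) :
    structure m (A1 `|` A2 : set U) :=
  induced (fun i => ambient S1 i `|` ambient S2 i) (A1 `|` A2).
Arguments free_amalgam {I m U A1 A2} S1 S2 i _.

(* Finite structures with overlapping domains are presented as structures on
   subsets A1 and A2 of a common type U; A1 `&` A2 may be empty. *)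
Definition free_amalgamation_property I (m : I -> nat)
    (C : forall T : Type, structure m T -> Prop) : Prop :=
  forall (U : Type) (A1 A2 : set U) (S1 : structure m A1) (S2 : structure m A2),
    C A1 S1 -> C A2 S2 ->
    induced (ambient S1) (A1 `&` A2) = induced (ambient S2) (A1 `&` A2) ->
    C (A1 `|` A2 : set U) (free_amalgam S1 S2).

(** * Words with constants *)

(* Letters: inl a is the constant a, inr (i, false) is x_i and inr (i, true)
   is x_i^-1. *)
Definition letter (G : groupType) (r : nat) : Type := (G + 'I_r * bool)%type.

(* The congruence on words presenting G * F_r: multiplication table of G, and
   free cancellation of the variables. *)
Inductive cong (G : groupType) (r : nat) :
    seq (letter G r) -> seq (letter G r) -> Prop :=
| cong_mul a b : cong [:: inl a; inl b] [:: inl (a * b)]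
| cong_one : cong [:: inl 1] [::]
| cong_var i b : cong [:: inr (i, b); inr (i, ~~ b)] [::]
| cong_refl s : cong s s
| cong_sym s t : cong s t -> cong t s
| cong_trans s t u : cong s t -> cong t u -> cong s u
| cong_cat s s' t t' : cong s s' -> cong t t' -> cong (s ++ t) (s' ++ t').

Section FreeProduct.
Variables (G : groupType) (r : nat).
Local Notation L := (letter G r).

HB.instance Definition _ := Choice.on L.

Definition congb (s t : seq L) : bool := `[< cong s t >].

Lemma congb_refl : reflexive congb.
Proof. by move=> s; apply/asboolP; exact: cong_refl. Qed.

Lemma congb_sym : symmetric congb.
Proof. by move=> s t; apply/asboolP/asboolP => /cong_sym. Qed.

Lemma congb_trans : transitive congb.
Proof.
by move=> t s u /asboolP st /asboolP tu; apply/asboolP; exact: cong_trans tu.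
Qed.

Canonical congb_equiv := EquivRel congb congb_refl congb_sym congb_trans.

(* The free product G * F_r. *)
Definition free_product : Type := {eq_quot congb}.

HB.instance Definition _ := Choice.on free_product.
HB.instance Definition _ := EqQuotient.on free_product.

Lemma free_productP (s t : seq L) :
  \pi_free_product s = \pi_free_product t <-> cong s t.
Proof. by split => [/eqmodP/asboolP//|st]; apply/eqmodP/asboolP. Qed.

Lemma cong_repr (s : seq L) : cong (repr (\pi_free_product s)) s.
Proof. by apply/free_productP; rewrite reprK. Qed.

Definition letter_inv (l : L) : L :=
  match l with inl a => inl a^-1 | inr (i, b) => inr (i, ~~ b) end.

Definition word_inv (s : seq L) : seq L := rev (map letter_inv s).

Lemma cong_letterV (l : L) : cong [:: letter_inv l; l] [::].
Proof.
case: l => [a|[i b]] /=.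
  by apply: cong_trans (cong_mul _ _ _) _; rewrite mulVg; exact: cong_one.
by rewrite -{2}[b]negbK; exact: cong_var.
Qed.

Lemma cong_Vletter (l : L) : cong [:: l; letter_inv l] [::].
Proof.
case: l => [a|[i b]] /=; last exact: cong_var.
by apply: cong_trans (cong_mul _ _ _) _; rewrite mulgV; exact: cong_one.
Qed.

Lemma cong_wordV (s : seq L) : cong (word_inv s ++ s) [::].
Proof.
elim: s => [|l s IH]; first exact: cong_refl.
rewrite /word_inv map_cons rev_cons -cats1 -catA -/(word_inv s).
apply: cong_trans IH; apply: cong_cat; first exact: cong_refl.
exact: (cong_cat (cong_letterV l) (cong_refl s)).
Qed.

Lemma cong_Vword (s : seq L) : cong (s ++ word_inv s) [::].
Proof.
elim: s => [|l s IH]; first exact: cong_refl.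
rewrite /word_inv map_cons rev_cons -cats1 -/(word_inv s) -cat1s -catA (catA s).
apply: cong_trans (cong_Vletter l); rewrite -[[:: l; _]]cat1s.
apply: cong_cat; first exact: cong_refl.
exact: (cong_cat IH (cong_refl _)).
Qed.

Definition fp_one : free_product := \pi_free_product [::].
Definition fp_mul (u v : free_product) : free_product :=
  \pi_free_product (repr u ++ repr v).
Definition fp_inv (u : free_product) : free_product :=
  \pi_free_product (word_inv (repr u)).

Lemma fp_mulE (s t : seq L) :
  fp_mul (\pi_free_product s) (\pi_free_product t) = \pi_free_product (s ++ t).
Proof. by apply/free_productP; apply: cong_cat; exact: cong_repr. Qed.

Lemma fp_mulA : associative fp_mul.
Proof.
move=> u v w; rewrite -[u]reprK -[v]reprK -[w]reprK.
move: (repr u) (repr v) (repr w) => s t z.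
by rewrite (fp_mulE t) (fp_mulE s t) (fp_mulE s) (fp_mulE (s ++ t)) catA.
Qed.

Lemma fp_mul1 : left_id fp_one fp_mul.
Proof. by move=> u; rewrite -[u]reprK fp_mulE. Qed.

Lemma fp_mulr1 : right_id fp_one fp_mul.
Proof. by move=> u; rewrite -[u]reprK fp_mulE cats0. Qed.

Lemma fp_mulV : left_inverse fp_one fp_inv fp_mul.
Proof.
move=> u; rewrite -{2}[u]reprK fp_mulE.
by apply/free_productP; exact: cong_wordV.
Qed.

Lemma fp_mulrV : right_inverse fp_one fp_inv fp_mul.
Proof.
move=> u; rewrite -{1}[u]reprK fp_mulE.
by apply/free_productP; exact: cong_Vword.
Qed.

HB.instance Definition _ :=
  isGroup.Build free_product fp_mulA fp_mul1 fp_mulr1 fp_mulV fp_mulrV.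

Definition fp_const (a : G) : free_product := \pi_free_product [:: inl a].
Definition fp_var (i : 'I_r) : free_product :=
  \pi_free_product [:: inr (i, false)].

Variable g : 'I_r -> G.

Definition letter_eval (l : L) : G :=
  match l with
  | inl a => a
  | inr (i, b) => if b then (g i)^-1 else g i
  end.

Definition word_eval (s : seq L) : G := \prod_(l <- s) letter_eval l.

Lemma word_eval_cong (s t : seq L) : cong s t -> word_eval s = word_eval t.
Proof.
rewrite /word_eval; elim => {s t} //=.
- by move=> a b; rewrite !big_cons big_nil /= mulg1 mulg1.
- by rewrite big_cons big_nil mulg1.
- by move=> i [] /=; rewrite !big_cons big_nil /= mulg1 ?mulVg ?mulgV.
- by move=> s t u _ -> _ ->.
- by move=> s s' t t' _ es _ et; rewrite !big_cat /= es et.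
Qed.

(* The value w(g_1, ..., g_r); fp_eval_unique identifies it with the
   homomorphism that is the identity on G and maps x_i to g_i. *)
Definition fp_eval (w : free_product) : G := word_eval (repr w).

Lemma fp_evalE (s : seq L) : fp_eval (\pi_free_product s) = word_eval s.
Proof. by apply: word_eval_cong; exact: cong_repr. Qed.

Lemma fp_evalM (u v : free_product) : fp_eval (u * v) = fp_eval u * fp_eval v.
Proof. by rewrite fp_evalE /word_eval big_cat. Qed.

Lemma fp_eval_const (a : G) : fp_eval (fp_const a) = a.
Proof. by rewrite fp_evalE /word_eval big_cons big_nil mulg1. Qed.

Lemma fp_eval_var (i : 'I_r) : fp_eval (fp_var i) = g i.
Proof. by rewrite fp_evalE /word_eval big_cons big_nil mulg1. Qed.

Lemma fp_eval_unique (phi : free_product -> G) :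
  {morph phi : u v / u * v} -> (forall a, phi (fp_const a) = a) ->
  (forall i, phi (fp_var i) = g i) -> phi =1 fp_eval.
Proof.
move=> phiM phiG phix u; rewrite -[u]reprK fp_evalE /word_eval.
elim: (repr u) => [|l s IH].
  rewrite big_nil; apply: (mulgI (phi 1)).
  by rewrite -[\pi_free_product [::]]/(1 : free_product) -phiM !mulg1.
rewrite big_cons -IH -cat1s -fp_mulE [LHS]phiM; congr (_ * _).
case: l => [a|[i [|]]] /=; [exact: phiG| |exact: phix].
apply: (mulgI (g i)); rewrite mulgV -{1}phix -phiM -[RHS](phiG 1).
congr phi; rewrite [LHS]fp_mulE; apply/free_productP.
exact: cong_trans (cong_var _ _ _) (cong_sym (cong_one _ _)).
Qed.

End FreeProduct.

Definition mixed_identity (G : groupType) (r : nat) (w : free_product G r) :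
    Prop :=
  w <> 1 /\ forall g : 'I_r -> G, fp_eval g w = 1.

(* Main.v *)
(* Write w = c_0 v_1 c_1 ... v_n c_n in reduced form and follow a point p along w,
   from right to left, choosing the values of the variables step by step.  Each
   letter v_j can be modified by the pointwise stabilizer of the finite set E of
   values already prescribed, so its new value can be any point of an orbit of
   this stabilizer outside E.  It suffices to pick there a point away from a
   given finite set and moved by the next constant c <> 1: then no later step
   conflicts with the earlier choices, and w moves p in the end.

   Such a point exists.  Suppose that c fixes the orbit P of b under the
   stabilizer of E, b not in E.  As Aut(X) <> Sym(X), there is a related tuple t
   with at least two values; taking t minimal, and embedding it so that all
   coordinates but a lie in P, while a is free from E and c a is free from t over
   E + {a}, the image of t under c contradicts freeness unless c a is in E + {a}.
   So c fixes almost all points that are free from E.  Repeating the argument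
   with P replaced by these points shows that c fixes all points outside E, and
   then, once more, that c = 1. *)
Require Import Defs.
From mathcomp Require Import all_boot all_classical.

Set Implicit Arguments.
Unset Strict Implicit.
Unset Printing Implicit Defensive.

Local Open Scope classical_set_scope.

(** * Injections and structures pulled back along them *)

Lemma restriction_bijective T U (A : set T) (f : T -> U) :
  {in A &, injective f} ->
  exists2 h : A -> (f @` A : set U), bijective h & forall a, \val (h a) = f (\val a).
Proof.
move=> injf.
have imf (a : A) : f (\val a) \in f @` A.
  by apply/mem_set; exists (\val a) => //; exact: set_mem (valP a).
have preim (b : f @` A : set U) : {a : A | f (\val a) = \val b}.
  apply: cid; have [x Ax <-] := set_mem (valP b).
  by exists (exist (fun x => x \in A) x (mem_set Ax)).
exists (fun a => exist (fun y => y \in f @` A) _ (imf a)) => //.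
exists (fun b => sval (preim b)) => [a|b].
  case: preim => a' /= ea; apply: val_inj; apply: injf ea; exact: valP.
by apply: val_inj => /=; case: preim.
Qed.

Section Pullback.
Variables (I : Type) (m : I -> nat) (X : Type) (R : structure m X).
Arguments R : clear implicits.

(** Used with [fst], so that tagged copies of points of [X] inherit the relations. *)
Definition pullback U (f : U -> X) : structure m U :=
  fun i => [set t | R i (f \o t)].

Lemma age_pullback U (f : U -> X) (A : set U) :
  finite_set A -> {in A &, injective f} -> age R (induced (pullback f) A).
Proof.
move=> finA /restriction_bijective[h bijh hE]; split.
  by rewrite (eq_finite_set (card_setT A)).
exists (f @` A), h; split => // i t.
rewrite /induced/pullback /=.
by suff -> : f \o (\val \o t) = \val \o (h \o t) by []; apply/funext => j; rewrite /= hE.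
Qed.

Lemma ambient_induced U (S : structure m U) (A : set U) i t :
  ambient (induced S A) i t <-> (forall j, A (t j)) /\ S i t.
Proof.
split=> [[s Ss <-]|[At St]].
  by split => // j; exact: set_mem (valP (s j)).
exists (fun j => exist (fun x => x \in A) (t j) (mem_set (At j))) => //.
Qed.

End Pullback.

(** * Automorphisms from homogeneity and free amalgamation *)

Section HomogeneousFree.
Variables (I : Type) (m : I -> nat) (X : choiceType) (R : structure m X).
Arguments R : clear implicits.
Hypothesis hhom : homogeneous R.

Lemma autP (g : aut R) i t : R i t <-> R i (g \o t).
Proof. exact: (aut_isom g).2. Qed.

Lemma aut_inj (g : aut R) : injective g.
Proof. exact: can_inj (aut_invK g).1. Qed.

Lemma homogeneous_extend (A : seq X) (f : X -> X) :
  {in A &, injective f} ->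
  (forall i t, (forall j, t j \in A) -> R i t <-> R i (f \o t)) ->
  exists g : aut R, {in A, g =1 f}.
Proof.
move=> injf isof.
have [|h bijh hE] := @restriction_bijective _ _ [set` A] f.
  by move=> x y /set_mem Ax /set_mem Ay; exact: injf.
have finA := finite_seq A.
have [|g gE] := hhom finA (finite_image f finA) (f := h).
- split=> // i t; rewrite /induced /= isof; last first.
    by move=> j; exact: set_mem (valP (t j)).
  suff -> : f \o (\val \o t) = \val \o (h \o t) by [].
  by apply/funext => j; rewrite /= hE.
exists g => x Ax.
have Ax' : x \in [set` A] by exact: mem_set.
by have := gE (exist _ x Ax'); rewrite hE.
Qed.

Hypothesis hfree : free_amalgamation_property (age R).

(* The overlap of the two domains is exactly [C]: points of [B] outside [C] are
   tagged [true], all points of [A] are tagged [false]. *)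
Lemma free_copy (A B C : seq X) : {subset C <= A} -> {subset C <= B} ->
  exists k : aut R, [/\ {in C, k =1 id},
    forall b, b \in B -> k b \in A -> b \in C
  & forall i t, R i t -> (forall j, t j \in A ++ map k B) ->
    (forall j, t j \in A) \/ (forall j, t j \in map k B)].
Proof.
move=> CA CB.
pose e1 (x : X) := (x, false); pose e2 (x : X) := (x, x \notin C).
pose A1 := [set` map e1 A]; pose A2 := [set` map e2 B].
have A1E x : x \in A -> A1 (e1 x) by exact: map_f.
have A2E x : x \in B -> A2 (e2 x) by exact: map_f.
have age1 : age R (induced (pullback R fst) A1).
  apply: age_pullback; first exact: finite_seq.
  by move=> _ _ /set_mem/mapP[x _ ->] /set_mem/mapP[y _ ->] /= ->.
have age2 : age R (induced (pullback R fst) A2).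
  apply: age_pullback; first exact: finite_seq.
  by move=> _ _ /set_mem/mapP[x _ ->] /set_mem/mapP[y _ ->] /= ->.
have [|_ [Z [phi [bij_phi phiE]]]] := hfree age1 age2.
  apply: functional_extensionality_dep => i; apply/seteqP; split=> t;
  by move=> /ambient_induced[_ Rt]; apply/ambient_induced; split=> // j;
    have [] := set_mem (valP (t j)).
pose W := A1 `|` A2.
(* [psi] realizes the amalgam inside [X]; the default [u.1] off [W] only makes it total. *)
pose psi (u : X * bool) : X := match pselect (W u) with
  | left Wu => \val (phi (exist (fun u => u \in W) u (mem_set Wu)))
  | right _ => u.1 end.
have psi_val (w : W) : psi (\val w) = \val (phi w).
  rewrite /psi; case: pselect => [Ww|[]]; last exact: set_mem (valP w).
  by congr (\val (phi _)); exact: val_inj.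
have psi_rel i (s : 'I_(m i) -> X * bool) : (forall j, W (s j)) ->
    R i (psi \o s) <->
    ((forall j, A1 (s j)) \/ (forall j, A2 (s j))) /\ R i (fst \o s).
  move=> Ws; pose u j : W := exist (fun u => u \in W) (s j) (mem_set (Ws j)).
  have -> : psi \o s = \val \o (phi \o u).
    by apply/funext => j /=; rewrite -psi_val.
  apply: (iff_trans (iff_sym (phiE i u))); rewrite /free_amalgam /induced /= /setU /=.
  have -> : \val \o u = s by [].
  rewrite !ambient_induced /pullback /=.
  by split=> [[[]|[]]|[[]]]; auto.
have psi_inj u v : W u -> W v -> psi u = psi v -> u = v.
  move=> Wu Wv euv.
  pose u' : W := exist (fun u => u \in W) u (mem_set Wu).
  pose v' : W := exist (fun u => u \in W) v (mem_set Wv).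
  have : phi u' = phi v' by apply: val_inj; rewrite -!psi_val.
  by move=> /(bij_inj bij_phi)/(congr1 \val).
have [||alpha alphaE] := homogeneous_extend (A := A) (f := psi \o e1).
- move=> x y Ax Ay exy.
  by case: (psi_inj _ _ (or_introl (A1E _ Ax)) (or_introl (A1E _ Ay)) exy).
- move=> i t At; rewrite -[(psi \o e1) \o t]/(psi \o (e1 \o t)) psi_rel.
    by split=> [Rt|[]//]; split=> //; left=> j; exact: A1E.
  by move=> j; left; exact: A1E.
have [||beta betaE] := homogeneous_extend (A := B) (f := psi \o e2).
- move=> x y Ax Ay exy.
  by case: (psi_inj _ _ (or_intror (A2E _ Ax)) (or_intror (A2E _ Ay)) exy).
- move=> i t At; rewrite -[(psi \o e2) \o t]/(psi \o (e2 \o t)) psi_rel.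
    by split=> [Rt|[]//]; split=> //; right=> j; exact: A2E.
  by move=> j; right; exact: A2E.
(* [alpha] and [beta] carry [A] and [B] to their images in the amalgam; going back by [alpha] puts
   [A] in place and makes [B] a free copy. *)
pose k : aut R := aut_mul (aut_inv alpha) beta.
have alphak x : alpha (k x) = beta x by exact: (aut_invK alpha).2.
exists k; split.
- move=> c Cc; apply: (aut_inj (g := alpha)).
  by rewrite alphak alphaE ?CA// betaE ?CB//= /e2 Cc.
- move=> b Bb Akb; have := alphak b; rewrite alphaE// betaE//.
  move=> /esym e.
  case: (psi_inj _ _ (or_intror (A2E _ Bb)) (or_introl (A1E _ Akb)) e) => _.
  exact: negbFE.
- move=> i t Rt At.
  pose s j := if t j \in A then e1 (t j) else e2 (aut_inv k (t j)).
  have sE j : W (s j) /\ psi (s j) = alpha (t j).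
    move: (At j); rewrite /s mem_cat; case: ifPn => /= [Atj _|_ /mapP[b Bb tjE]].
      by split; [left; exact: A1E|rewrite alphaE].
    rewrite tjE (aut_invK k).1; split; first by right; exact: A2E.
    by rewrite alphak betaE.
  have Rs : R i (psi \o s).
    suff -> : psi \o s = alpha \o t by exact: (@autP alpha i t).1.
    by apply/funext => j /=; exact: (sE j).2.
  have [[sA1|sA2] _] := (psi_rel i s (fun j => (sE j).1)).1 Rs.
    left=> j; have [_] := sE j; have /mapP[x Ax ->] := sA1 j.
    rewrite -[psi (e1 x)]/((psi \o e1) x) -alphaE//.
    by move=> /(@aut_inj alpha) <-.
  right=> j; have [_] := sE j; have /mapP[x Bx ->] := sA2 j.
  rewrite -[psi (e2 x)]/((psi \o e2) x) -betaE// -alphak.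
  by move=> /(@aut_inj alpha) <-; exact: map_f.
Qed.

(** * Constant tuples, discrete sets and free points *)

Hypothesis htrans : transitive_aut R.

Definition constant_tuple n (t : 'I_n -> X) := forall j j', t j = t j'.

(** By transitivity some automorphism agrees with [f] at the single value of [t]; in arity 0
    composing with [f] changes nothing. *)
Lemma constant_tuple_map i (t : 'I_(m i) -> X) (f : X -> X) :
  constant_tuple t -> R i t -> R i (f \o t).
Proof.
move=> ct Rt; have [j _|n0] := pickP (fun _ : 'I_(m i) => true).
  have [g gE] := htrans (t j) (f (t j)).
  suff -> : f \o t = g \o t by exact: (@autP g i t).1.
  by apply/funext => j' /=; rewrite (ct j' j) gE.
suff -> : f \o t = t by [].
by apply/funext => j; have := n0 j.
Qed.

(** Constant tuples are allowed, as by transitivity they do not distinguish points. *)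
Definition discrete (D : seq X) :=
  forall i t, R i t -> (forall j, t j \in D) -> constant_tuple t.

(** The structure on [a :: E] is the free amalgam of [a] and [E] over the empty set. *)
Definition free_point (E : seq X) (a : X) := a \notin E /\
  forall i t, R i t -> (forall j, t j \in a :: E) ->
    (forall j, t j \in E) \/ (forall j, t j = a).

(** Only constant tuples occur on either side, so by transitivity any bijection between the two sets
    is a partial isomorphism. *)
Lemma discrete_extend (D : seq X) (u : X -> X) :
  discrete D -> discrete (map u D) -> {in D &, injective u} ->
  exists h : aut R, {in D, h =1 u}.
Proof.
move=> dD duD uinj; apply: homogeneous_extend => // i t Dt; split=> Rt.
  by apply: constant_tuple_map => //; exact: (dD i).
have ct : constant_tuple t.
  move=> j j'; apply: uinj => //.
  by apply: (duD i (u \o t)) => // l; exact: map_f.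
have [j _|n0] := pickP (fun _ : 'I_(m i) => true); last first.
  suff <- : u \o t = t by [].
  by apply/funext => j; have := n0 j.
suff -> : t = (fun _ => t j) \o (u \o t).
  by apply: constant_tuple_map => // l l' /=; rewrite (ct l l').
by apply/funext => l /=; exact: ct.
Qed.

(** No related tuple joins [a] or [b] to [E], so the identity of [E] extended by [a] to [b] is a
    partial isomorphism. *)
Lemma free_point_conj (E : seq X) (a b : X) :
  free_point E a -> free_point E b ->
  exists2 h : aut R, {in E, h =1 id} & h a = b.
Proof.
move=> [aE fa] [bE fb].
pose f x := if x == a then b else x.
have fE : {in E, f =1 id}.
  by move=> x Ex; rewrite /f; case: eqP Ex aE => // -> ->.
have finj : {in a :: E &, injective f}.
  move=> x y; rewrite /f !inE; have [->|_] /= := eqVneq x a.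
    have [->//|_ _ /= Ey bEy] := eqVneq y a.
    by rewrite bEy Ey in bE.
  have [->|//] := eqVneq y a.
  by move=> Ex _ xb; rewrite -xb Ex in bE.
have [|h hE] := homogeneous_extend finj.
  move=> i t tE; split=> Rt.
    have [tE'|ta] := fa _ _ Rt tE; last first.
      by apply: constant_tuple_map => // j j'; rewrite !ta.
    suff -> : f \o t = t by [].
    by apply/funext => j /=; rewrite fE.
  have [j|ftE|ftb] := fb _ _ Rt.
  + rewrite /= /f inE; have [_|ta] := eqVneq (t j) a; first by rewrite eqxx.
    by have := tE j; rewrite inE (negPf ta) /= => ->; rewrite orbT.
  + suff <- : f \o t = t by [].
    apply/funext => j; have := ftE j; rewrite /= /f.
    by case: eqP => // _ bE'; rewrite bE' in bE.
  + have ta j : t j = a.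
      apply: finj; rewrite ?inE ?eqxx//; first by have := tE j.
      by rewrite [LHS]ftb /f eqxx.
    suff -> : t = (fun _ => a) \o (f \o t).
      by apply: constant_tuple_map => // j j'; rewrite !ftb.
    by apply/funext => j; exact: ta.
exists h => [x Ex|]; rewrite hE ?inE ?eqxx ?Ex ?orbT//; first exact: fE.
by rewrite /f eqxx.
Qed.

(** * Related tuples with at least two values *)

Hypothesis hSym :
  [set f : X -> X | isomorphism R R f] <> [set f : X -> X | bijective f].

(** Otherwise transitivity makes every bijection an automorphism, against [hSym]. *)
Lemma exists_nonconstant_tuple :
  exists i (t : 'I_(m i) -> X), R i t /\ ~ constant_tuple t.
Proof.
apply: contrapT => all_const; apply: hSym.
have ct i (t : 'I_(m i) -> X) : R i t -> constant_tuple t.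
  by move=> Rt; apply: contrapT => nct; apply: all_const; exists i, t.
apply/seteqP; split=> f /=; first by case.
move=> bf; split=> // i t; split=> Rt.
  by apply: constant_tuple_map => //; exact: ct.
have [f' fK _] := bf.
have -> : t = f' \o (f \o t) by apply/funext => j /=; rewrite fK.
by apply: constant_tuple_map => //; exact: ct.
Qed.

(** Induction on the number of values: if those other than [t0 j0] are not discrete, they contain a
    smaller non-constant tuple. *)
Lemma exists_minimal_tuple :
  exists (D : seq X) i (t : 'I_(m i) -> X) j0 j1,
    [/\ discrete D, R i t, t j1 <> t j0, t j0 \notin D
      & forall j, t j <> t j0 -> t j \in D].
Proof.
have [i0 [t0 [Rt0 nct0]]] := exists_nonconstant_tuple.
have : forall j, t0 j \in codom t0 by exact: codom_f.
have [n] : exists n, size (codom t0) <= n by exists (size (codom t0)).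
move: (codom t0) => s sn t0s.
elim: n => [|n IHn] in s i0 t0 Rt0 nct0 sn t0s *.
  exfalso; apply: nct0 => j; have := t0s j.
  by move: sn; rewrite leqn0 size_eq0 => /eqP ->.
have [j1 /existsNP[j0 t10]] : exists j1, ~ forall j0, t0 j1 = t0 j0.
  exact/existsNP.
pose D := [seq x <- s | x != t0 j0].
have Dj0 : t0 j0 \notin D by rewrite mem_filter eqxx.
have [dD|] := pselect (discrete D).
  exists D, i0, t0, j0, j1; split=> // j /eqP tj.
  by rewrite mem_filter tj t0s.
move=> /existsNP[i1 /existsNP[t1 /not_implyP[Rt1 /not_implyP[t1D nct1]]]].
apply: (IHn D i1 t1) => //.
rewrite -ltnS (leq_trans _ sn)// /D size_filter -(count_predC (pred1 (t0 j0)) s).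
by rewrite -[X in X < _]add0n ltn_add2r -has_count has_pred1.
Qed.

(** * Orbits of pointwise stabilizers and the points moved in them *)

Definition stabilizer_orbit (E : seq X) (b x : X) :=
  exists2 h : aut R, {in E, h =1 id} & h b = x.

Lemma stabilizer_orbit_notin (E : seq X) (b x : X) :
  b \notin E -> stabilizer_orbit E b x -> x \notin E.
Proof.
move=> bE [h hE <-]; apply: contra bE => hbE.
by have /(@aut_inj h) <- := hE _ hbE.
Qed.

Lemma stabilizer_orbit_aut (E : seq X) (b x : X) (k : aut R) :
  {in E, k =1 id} -> stabilizer_orbit E b x -> stabilizer_orbit E b (k x).
Proof.
move=> kE [h hE <-]; exists (aut_mul k h) => // e Ee.
by rewrite /= hE// kE.
Qed.

(** Each new point is a free copy of [b] over [E], so no related tuple joins it to the earlier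
    copies. *)
Lemma discrete_copies (E : seq X) (b : X) (s : seq X) : b \notin E ->
  exists u : X -> X, [/\ {in s &, injective u}, discrete (map u s)
    & forall x, x \in s -> stabilizer_orbit E b (u x)].
Proof.
move=> bE; elim: s => [|y s [u [uinj du uP]]].
  exists id; split=> // i t _ tn j; by have := tn j.
have [ys|ys] := boolP (y \in s).
  exists u; split.
  - move=> x x'; rewrite !inE.
    by move=> /predU1P[->|xs] /predU1P[->|x's]; exact: uinj.
  - move=> i t Rt tu; apply: (du i) => // j; have := tu j.
    by rewrite inE => /predU1P[->|//]; exact: map_f.
  - by move=> x; rewrite inE => /predU1P[->|]; exact: uP.
have [||k [kE kA kR]] := @free_copy (E ++ map u s) (b :: E) E.
- by move=> x xE; rewrite mem_cat xE.
- by move=> x xE; rewrite inE xE orbT.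
have kb : k b \notin E ++ map u s.
  by apply: contra bE => /kA; apply; rewrite inE eqxx.
pose u' x := if x == y then k b else u x.
have u'y : u' y = k b by rewrite /u' eqxx.
have u's x : x \in s -> u' x = u x.
  by rewrite /u'; case: eqP => // ->; rewrite (negPf ys).
have map_u' : map u' s = map u s by apply/eq_in_map.
have us x : x \in map u s -> x \notin E.
  by move=> /mapP[z zs ->]; exact: stabilizer_orbit_notin (uP _ zs).
have u'inj x : x \in s -> u x <> k b.
  move=> xs ux; move: kb; rewrite -ux mem_cat negb_or => /andP[_].
  by rewrite map_f.
exists u'; split.
- move=> x x'; rewrite !inE.
  move=> /predU1P[->|xs] /predU1P[->|x's]; rewrite ?u'y ?u's//.
  + by move=> /esym/(u'inj _ x's).
  + by move=> /(u'inj _ xs).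
  + exact: uinj.
- move=> i t Rt; rewrite /= map_u' u'y => tu.
  have [j|tA|tB] := kR _ _ Rt.
  + have := tu j; rewrite mem_cat mem_cat !inE => /predU1P[->|->].
      by rewrite eqxx !orbT.
    by rewrite orbT.
  + apply: (du i) => // j; have := tu j; rewrite inE => /predU1P[tj|//].
    by have := tA j; rewrite tj (negPf kb).
  + move=> j j'; suff tk l : t l = k b by rewrite !tk.
    have := tu l; rewrite inE => /predU1P[//|/us tlE].
    have := tB l; rewrite inE => /predU1P[//|/mapP[e Ee tl]].
    by rewrite tl kE// Ee in tlE.
- move=> x; rewrite inE => /predU1P[->|xs]; first by rewrite u'y; exists k.
  by rewrite u's//; exact: uP.
Qed.

(** For a minimal tuple, [h] moves [D] into the orbit, [k] frees the remaining point from [E] while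
    fixing that image, and [l], fixing [E], brings this point to [a]. *)
Lemma tuple_with_coordinates_in_orbit (E : seq X) (a b : X) :
  b \notin E -> free_point E a ->
  exists i (t : 'I_(m i) -> X) j0 j1, [/\ R i t, t j0 = a, t j1 <> a
    & forall j, t j <> a -> stabilizer_orbit E b (t j)].
Proof.
move=> bE fa.
have [D [i [t [j0 [j1 [dD Rt t10 j0D tD]]]]]] := exists_minimal_tuple.
have [u [uinj du uP]] := discrete_copies D bE.
have [h hu] := discrete_extend dD du uinj.
pose V := map u D; pose a1 := h (t j0).
have VE x : x \in V -> x \notin E.
  by move=> /mapP[z zD ->]; exact: stabilizer_orbit_notin (uP _ zD).
have a1V : a1 \notin V.
  apply: contra j0D => /mapP[x xD]; rewrite -hu// => /(@aut_inj h).
  by move=> ->.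
have [||k [kV kA kR]] := @free_copy (E ++ V) (a1 :: V) V.
- by move=> x xE; rewrite mem_cat xE orbT.
- by move=> x xE; rewrite inE xE orbT.
have ka1 : k a1 \notin E ++ V.
  by apply: contra a1V => /kA; apply; rewrite inE eqxx.
have fka1 : free_point E (k a1).
  split; first by move: ka1; rewrite mem_cat negb_or => /andP[].
  move=> i' t' Rt' t'E; have [j|tA|tB] := kR _ _ Rt'.
  + have := t'E j; rewrite !mem_cat !inE => /predU1P[->|->//].
    by rewrite eqxx !orbT.
  + left=> j; have := t'E j; rewrite inE => /predU1P[tj|//].
    by have := tA j; rewrite tj (negPf ka1).
  + right=> j; have := t'E j; rewrite inE => /predU1P[//|tjE].
    have := tB j; rewrite inE => /predU1P[//|/mapP[v vV tj]].
    by move: tjE; rewrite tj kV// (negPf (VE _ vV)).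
have [l lE la] := free_point_conj fka1 fa.
pose g := aut_mul l (aut_mul k h).
have ga : g (t j0) = a by [].
exists i, (g \o t), j0, j1; split=> //; first exact: (@autP g i t).1.
  by rewrite /comp -ga => /(@aut_inj g).
move=> j gtj; have tj : t j <> t j0 by move=> tj; apply: gtj; rewrite /= tj.
rewrite /= hu ?tD// kV ?map_f ?tD//.
by apply: stabilizer_orbit_aut => //; apply: uP; exact: tD.
Qed.

(* If [g (t j0)] were outside [C], amalgamating it freely with a copy of [t] over
   [C] would contradict the tuple [g (k t)], which joins [g (t j0)] to the fixed
   point [k (t j1)]. *)
Lemma moved_in_base (g : aut R) (A C : seq X) i (t : 'I_(m i) -> X) j0 j1 :
  {subset C <= A} -> g (t j0) \in A -> t j0 \in C -> t j1 \notin C -> R i t ->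
  (forall k : aut R, {in C, k =1 id} ->
    (forall j, k (t j) \in A -> t j \in C) ->
    (forall i' (t' : 'I_(m i') -> X), R i' t' ->
      (forall j, t' j \in A ++ map k (C ++ codom t)) ->
      (forall j, t' j \in A) \/ (forall j, t' j \in map k (C ++ codom t))) ->
    forall j, t j <> t j0 -> g (k (t j)) = k (t j)) ->
  g (t j0) \in C.
Proof.
move=> CA gA j0C j1C Rt fixg.
have [//||k [kC kA kR]] := @free_copy A (C ++ codom t) C.
  by move=> x xC; rewrite mem_cat xC.
have tB j : t j \in C ++ codom t by rewrite mem_cat codom_f orbT.
have {}fixg := fixg k kC (fun j => kA _ (tB j)) kR.
have Rgkt := (@autP (aut_mul g k) _ _).1 Rt.
(* If the tuple lies in [A], then so does [k (t j1)], which forces [t j1] into [C]; if it lies in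
   the copy, [g (t j0)] is in both parts, hence in [C]. *)
have [j|tA|tk] := kR _ _ Rgkt.
- rewrite mem_cat /=; have [->|/eqP tj] := eqVneq (t j) (t j0).
    by rewrite kC// gA.
  by rewrite fixg// map_f ?orbT.
- have j10 : t j1 <> t j0 by move=> t10; rewrite t10 j0C in j1C.
  have := tA j1; rewrite /= fixg// => /(kA _ (tB j1)).
  by rewrite (negPf j1C).
- have := tk j0; rewrite /= kC// => /mapP[y yB gy].
  have yC : y \in C by apply: kA => //; rewrite -gy.
  by rewrite gy kC.
Qed.

(** Take [a :: E] as base: copies over it keep the other coordinates in the orbit, where [g] is the
    identity. *)
Lemma fixes_free_points (g : aut R) (E : seq X) (a b : X) : b \notin E ->
  (forall x, stabilizer_orbit E b x -> g x = x) -> free_point E a ->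
  g a \in a :: E.
Proof.
move=> bE gP fa.
have [i [t [j0 [j1 [Rt ta t1a tP]]]]] := tuple_with_coordinates_in_orbit bE fa.
rewrite -{a}ta in fa t1a tP *.
apply: (@moved_in_base g (g (t j0) :: t j0 :: E) _ i t j0 j1) => //.
- by move=> x xE; rewrite inE xE orbT.
- by rewrite inE eqxx.
- by rewrite inE eqxx.
- rewrite inE negb_or (stabilizer_orbit_notin bE (tP _ t1a)) andbT.
  exact/eqP.
- move=> k kC _ _ j tj; apply: gP; apply: stabilizer_orbit_aut; last exact: tP.
  by move=> e Ee; apply: kC; rewrite inE Ee orbT.
Qed.

Lemma nonconstant_tuple_at (a : X) :
  exists i (t : 'I_(m i) -> X) j0 j1, [/\ R i t, t j0 = a & t j1 <> a].
Proof.
have [D [i [t [j0 [j1 [_ Rt t10 _ _]]]]]] := exists_minimal_tuple.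
have [h ha] := htrans (t j0) a.
exists i, (h \o t), j0, j1; split=> //; first exact: (@autP h i t).1.
by rewrite /comp -ha => /(@aut_inj h).
Qed.

(** Two passes over a one-point base: for a point outside [E] the copied coordinates are free from
    [E]; for an arbitrary point they are taken outside [E], where [g] is by then the identity. *)
Lemma fixes_all_points (g : aut R) (E : seq X) :
  (forall a, free_point E a -> g a \in a :: E) -> g =1 id.
Proof.
move=> gfree.
have fix_outside a : a \notin E -> g a = a.
  have [i [t [j0 [j1 [Rt <- t1a]]]]] := nonconstant_tuple_at a => aE.
  (* The preimage of [E] is included so that [g] sends no copied coordinate into [E]. *)
  pose A := g (t j0) :: t j0 :: E ++ map (aut_inv g) E.
  apply/eqP; rewrite -mem_seq1.
  apply: (@moved_in_base g A _ i t j0 j1) => //.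
  - by move=> x; rewrite !inE => ->; rewrite orbT.
  - by rewrite inE eqxx.
  - by rewrite inE.
  - by rewrite inE; apply/eqP.
  - move=> k kC kA kR j tj.
    have : k (t j) \notin A.
      by apply/negP => /kA; rewrite inE => /eqP.
    rewrite !inE !negb_or mem_cat negb_or => /and4P[_ ktj0 ktE ktgE].
    have : g (k (t j)) \in k (t j) :: E.
      apply: gfree; split=> // i' t' Rt' t'E; have [l|tA|tk] := kR _ _ Rt'.
      + rewrite mem_cat; have := t'E l; rewrite inE => /predU1P[->|tE].
          by rewrite map_f ?orbT// mem_cat codom_f orbT.
        by rewrite !inE mem_cat tE !orbT.
      + left=> l; have := t'E l; rewrite inE => /predU1P[tl|//].
        have := tA l; rewrite tl => /kA; rewrite inE => /eqP//.
      + right=> l; have := t'E l; rewrite inE => /predU1P[//|tlE].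
        have /mapP[y yB tl] := tk l.
        move: yB; rewrite mem_cat inE => /predU1P yB.
        have yC : y = t j0.
          case: yB => [//|/codomP[l' yE]]; rewrite yE.
          have /kA : k (t l') \in A by rewrite -yE -tl !inE mem_cat tlE !orbT.
          by rewrite inE => /eqP.
        by move: tlE; rewrite tl yC kC ?inE// (negPf aE).
    rewrite inE => /predU1P[//|gE]; move: ktgE.
    by rewrite -{1}[k (t j)](aut_invK g).1 map_f.
move=> a; have [i [t [j0 [j1 [Rt <- t1a]]]]] := nonconstant_tuple_at a.
apply/eqP; rewrite -mem_seq1.
apply: (@moved_in_base g (g (t j0) :: t j0 :: E) _ i t j0 j1) => //.
- by move=> x; rewrite !inE => ->; rewrite orbT.
- by rewrite inE eqxx.
- by rewrite inE.
- by rewrite inE; apply/eqP.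
- move=> k kC kA _ j tj; apply: fix_outside; apply/negP => kE.
  by have := kA j; rewrite !inE kE !orbT => /(_ isT)/eqP.
Qed.

Lemma moves_in_orbit (g : aut R) (E : seq X) (b : X) :
  b \notin E -> g <> 1%g -> exists2 x, stabilizer_orbit E b x & g x <> x.
Proof.
move=> bE g1; apply: contrapT => nex; apply: g1; apply: aut_ext.
apply: (@fixes_all_points g E) => a fa.
apply: (@fixes_free_points g E a b) => // x Px.
by apply: contrapT => gx; apply: nex; exists x.
Qed.

(** * Modifying an automorphism outside a finite set *)

Lemma orbit_avoids (E F : seq X) (b : X) :
  b \notin E -> exists2 x, stabilizer_orbit E b x & x \notin E ++ F.
Proof.
move=> bE.
have [||k [kE kA _]] := @free_copy (E ++ F) (b :: E) E.
- by move=> x xE; rewrite mem_cat xE.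
- by move=> x xE; rewrite inE xE orbT.
exists (k b); first by exists k.
by apply: contra bE => /kA; apply; rewrite inE eqxx.
Qed.

Lemma modify_aut (y0 : aut R) (E F : seq X) (d : X) (c : aut R) : d \notin E ->
  exists y : aut R,
    [/\ {in E, y =1 y0}, y d \notin F & c (y d) = y d -> c = 1%g].
Proof.
move=> dE; have bE : y0 d \notin map y0 E by rewrite mem_map//; exact: aut_inj.
have [b [k kE kb] bF] := orbit_avoids F bE.
(* Fixing [F] as well keeps the value outside [F] while moving it to a point moved by [c]. *)
have [h [hEF hc]] : exists h : aut R,
    {in map y0 E ++ F, h =1 id} /\ (c (h b) = h b -> c = 1%g).
  have [->|c1] := pselect (c = 1%g); first by exists 1%g.
  have [_ [h hEF <-] chb] := moves_in_orbit bF c1.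
  by exists h; split=> // /chb.
exists (aut_mul h (aut_mul k y0)); split=> [e Ee| |].
- by rewrite /= kE ?hEF ?mem_cat ?map_f.
- rewrite /= kb; have : stabilizer_orbit (map y0 E ++ F) b (h b) by exists h.
  move=> /(stabilizer_orbit_notin bF); rewrite mem_cat negb_or.
  by move=> /andP[].
- by rewrite /= kb.
Qed.

End HomogeneousFree.

(** * Reduced words in the free product *)

Section ReducedWords.
Variables (G : groupType) (r : nat).

Definition var_inv (v : 'I_r * bool) := (v.1, ~~ v.2).

Lemma var_invK : involutive var_inv.
Proof. by move=> [i b]; rewrite /var_inv /= negbK. Qed.

(** Encodes [v_1 c_1 ... v_n c_n]; the constant in front is kept apart. *)
Definition syllable_word (l : seq (('I_r * bool) * G)) : seq (letter G r) :=
  flatten [seq [:: inr p.1; inl p.2] | p <- l].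

Definition no_cancel (l : seq (('I_r * bool) * G)) (c : G) (v : 'I_r * bool) :=
  if l is (v1, _) :: _ then c = 1%g -> v <> var_inv v1 else True.

Fixpoint reduced (l : seq (('I_r * bool) * G)) : Prop :=
  if l is (v, c) :: l' then no_cancel l' c v /\ reduced l' else True.
Lemma cong_reduced (s : seq (letter G r)) :
  exists c l, reduced l /\ cong s (inl c :: syllable_word l).
Proof.
elim: s => [|a s [c [l [redl sl]]]].
  by exists 1%g, [::]; split=> //; exact: cong_sym (cong_one _ _).
have consl (a' : letter G r) (s1 s2 : seq (letter G r)) :
  cong s1 s2 -> cong (a' :: s1) (a' :: s2).
  by move=> ss; exact: (cong_cat (cong_refl [:: a']) ss).
case: a => [a|v].
  exists (a * c)%g, l; split=> //; apply: cong_trans (consl _ _ _ sl) _.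
  exact: (cong_cat (cong_mul _ a c) (cong_refl _)).
have [vl|nvl] := pselect (no_cancel l c v).
  exists 1%g, ((v, c) :: l); split=> //.
  apply: cong_trans (consl _ _ _ sl) _.
  exact: (cong_cat (cong_sym (cong_one _ _)) (cong_refl (inr v :: inl c :: _))).
(* Here the new letter meets its inverse across the constant 1: both cancel and [c1] becomes the
   leading constant. *)
case: l redl sl nvl => [|[v1 c1] l] /= redl sl; first by case.
move=> /not_implyP[c1E /contrapT vE]; exists c1, l; split; first by case: redl.
apply: cong_trans (consl _ _ _ sl) _; rewrite c1E vE.
have step (u1 u2 t : seq (letter G r)) : cong u1 u2 -> cong (u1 ++ t) (u2 ++ t).
  by move=> uu; exact: cong_cat uu (cong_refl t).
apply: cong_trans (consl _ _ _ (step _ _ (inr v1 :: _) (cong_one G r))) _ => /=.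
have := cong_var G (var_inv v1).1 (var_inv v1).2.
rewrite -/(var_inv _) var_invK; case: v1 => i b in vE redl sl *.
exact: (step _ _ (inl c1 :: syllable_word l)).
Qed.

End ReducedWords.

Lemma word_eval_cons (G : groupType) r (x : 'I_r -> G) a s :
  word_eval x (a :: s) = (letter_eval x a * word_eval x s)%g.
Proof. exact: big_cons. Qed.

(** * Values of reduced words *)

Section WordValues.
Variables (I : Type) (m : I -> nat) (X : choiceType) (R : structure m X).
Hypothesis hhom : homogeneous R.
Hypothesis hfree : free_amalgamation_property (age R).
Hypothesis htrans : transitive_aut R.
Hypothesis hSym :
  [set f : X -> X | isomorphism R R f] <> [set f : X -> X | bijective f].
Variable r : nat.

Definition satisfies (x : 'I_r -> aut R) (L : seq (('I_r * bool) * (X * X))) :=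
  forall v a b, (v, (a, b)) \in L -> letter_eval x (inr v) a = b.

(** Only the variable of [v] changes, which is possible as [d] is outside the domain prescribed for
    [v]; symmetry of [L] carries the agreement over to the inverse letter. *)
Lemma modify_assignment (x : 'I_r -> aut R) L v d (F : seq X) (c : aut R) :
  (forall v a b, (v, (a, b)) \in L -> (var_inv v, (b, a)) \in L) ->
  satisfies x L -> (forall b, (v, (d, b)) \notin L) ->
  exists (x' : 'I_r -> aut R) q, [/\
    satisfies x' ((v, (d, q)) :: (var_inv v, (q, d)) :: L),
    q \notin F & c q = q -> c = 1%g].
Proof.
move=> Lsym xL dL.
pose E := [seq p.2.1 | p <- L & p.1 == v].
have LE a b : (v, (a, b)) \in L -> a \in E.
  move=> La; apply/mapP; exists (v, (a, b)) => //.
  by rewrite mem_filter eqxx.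
have dE : d \notin E.
  apply/negP => /mapP[[w [a b]]]; rewrite mem_filter /= => /andP[/eqP->].
  by move=> Lab da; have := dL b; rewrite da Lab.
have [y [yE yF yc]] :=
  modify_aut hhom hfree htrans hSym (letter_eval x (inr v)) F c dE.
pose x' j := if j == v.1 then if v.2 then (y^-1)%g else y else x j.
have x'v : letter_eval x' (inr v) = y.
  by case: v @x' {dL E LE dE yE} => i [] x' /=; rewrite /x' eqxx ?invgK.
have x'V : letter_eval x' (inr (var_inv v)) = (y^-1)%g.
  by case: v @x' {dL E LE dE yE x'v} => i [] x' /=; rewrite /x' eqxx.
exists x', (y d); split=> // w a b; rewrite !inE => /or3P[/eqP[-> -> ->]||Lab].
- by rewrite x'v.
- by move=> /eqP[-> -> ->]; rewrite x'V; exact: (aut_invK y).1.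
have [wv|wv] := eqVneq w.1 v.1; last first.
  by rewrite -(xL _ _ _ Lab); case: w wv {Lab} => j b' /= /negPf; rewrite /x' => ->.
have [wE|wE] : w = v \/ w = var_inv v.
  case: w v {Lab x' x'v x'V dL E LE dE yE} wv => [i []] [j []] /= ->; auto.
- rewrite wE in Lab *; rewrite x'v yE; last exact: LE Lab.
  exact: xL.
- have Lba : (v, (b, a)) \in L by have := Lsym _ _ _ Lab; rewrite wE var_invK.
  rewrite wE x'V -(xL _ _ _ Lba) -yE; last exact: LE Lba.
  exact: (aut_invK y).1.
Qed.

(* [L] lists finitely many values of the letters, closed under inversion, on
   which the trajectory of [p] along the word depends; [c] is the constant met
   next, and its image of the current point is fresh for every admissible next
   letter. *)
Lemma reduced_word_trajectory (p : X) (l : seq (('I_r * bool) * aut R)) :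
  reduced l -> forall c : aut R, exists (x : 'I_r -> aut R) L,
  let q := word_eval x (syllable_word l) p in
  [/\ forall v a b, (v, (a, b)) \in L -> (var_inv v, (b, a)) \in L,
    satisfies x L,
    forall x', satisfies x' L -> word_eval x' (syllable_word l) p = q,
    forall v b, no_cancel l c v -> (v, (c q, b)) \notin L
  & l <> [::] -> c q <> p].
Proof.
elim: l => [_ c|[v1 c1] l IHl [ncl redl] c].
  exists (fun _ => 1%g), [::] => /=; split=> //.
  by move=> x' _; rewrite /word_eval !big_nil.
have [x [L /= [Lsym xL Lstable cL _]]] := IHl redl c1.
set d := c1 _ in cL.
(* The points that [c q] has to avoid: [p], to be moved in the end, and those where letters already
   have prescribed values. *)
pose pts := p :: d :: [seq e.2.1 | e <- L].
have [x' [q [x'L qF qc]]] := modify_assignment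
  (pts ++ map (aut_inv c) pts) c Lsym xL (fun b => cL _ b ncl).
set L' := [:: _, _ & L] in x'L.
have cq : c q \notin pts.
  apply: contra qF => cq; rewrite mem_cat -{2}[q](aut_invK c).1.
  by rewrite map_f ?orbT.
have val y : satisfies y L' -> word_eval y (syllable_word ((v1, c1) :: l)) p = q.
  move=> yL'; rewrite /= !word_eval_cons !aut_mulE /= Lstable.
    by apply: yL'; rewrite inE eqxx.
  by move=> v a b Lab; apply: yL'; rewrite !inE Lab !orbT.
exists x', L' => /=; rewrite (val _ x'L); split=> //.
- move=> v a b; rewrite !inE => /or3P[/eqP[-> -> ->]|/eqP[-> -> ->]|/Lsym ->].
  + by rewrite eqxx orbT.
  + by rewrite var_invK eqxx.
  + by rewrite !orbT.
- move: cq; rewrite !inE !negb_or => /and3P[_ cqd cqL] v b nc.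
  (* A clash with the new inverse entry would need [c q = q], hence [c = 1], and then [v] would
     cancel against [v1]. *)
  rewrite !inE !negb_or !xpair_eqE (negPf cqd) /= !andbF /=.
  apply/andP; split.
    apply/negP => /andP[/eqP vE /andP[/eqP cqq _]].
    exact: nc (qc cqq) vE.
  by apply: contra cqL => Lb; apply/mapP; exists (v, (c q, b)).
- by move=> _ cqp; move: cq; rewrite cqp inE eqxx.
Qed.

End WordValues.

Theorem theorem4p2p2 (I : Type) (m : I -> nat) (X : Type) (R : structure m X)
  (hcount : countable [set: X])
  (hhom : homogeneous R)
  (holig : oligomorphic R)
  (hfree : free_amalgamation_property (age R))
  (htrans : transitive_aut R)
  (hSym : [set f : X -> X | isomorphism R R f] <> [set f : X -> X | bijective f])
  (r : nat) :
  ~ exists w : free_product (aut R) r, mixed_identity w.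
Proof.
move=> [w [w1 wid]].
have [c [l [redl wl]]] := cong_reduced (repr w).
have evalw x : (c * word_eval x (syllable_word l))%g = 1%g.
  by rewrite -(wid x) /fp_eval (word_eval_cong x wl) word_eval_cons.
(* Without variables, [w] is the constant [c], and its value forces [c = 1]. *)
case: l => [|s l] in redl wl evalw.
  apply: w1; rewrite -[w]reprK; apply/free_productP.
  apply: cong_trans wl _; have := evalw (fun=> 1%g).
  rewrite /word_eval big_nil mulg1 => ->; exact: cong_one.
(* [X] is nonempty since it carries a non-constant tuple; [{classic X}] provides the choice
   structure. *)
have [p _] : exists p : X, True.
  have [_ [i [t [j0 _]]]] :=
    @exists_minimal_tuple I m {classic X} R htrans hSym.
  by exists (t j0).
have [x [L /= [_ _ _ _]]] :=
  @reduced_word_trajectory I m {classic X} R hhom hfree htrans hSym r p _ redl c.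
by case=> //; have /(congr1 (fun g : aut R => g p)) := evalw x.
Qed.
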